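(* Let $(\boldsymbol\Theta,\boldsymbol\delta)=(\Theta_i,\delta_i)_{i\in[n]}$ be a hierarchical prediction profile, i.e. $\Theta_1\subseteq\Theta_2\subseteq\cdots\subseteq\Theta_n\subseteq\mathcal{I}$ and $1\ge\delta_1\ge\delta_2\ge\cdots\ge\delta_n\ge 0$, and set $\delta_0=1$. Then for every algorithm $A$, $$\mathrm{DRCR}_{\boldsymbol\Theta,\boldsymbol\delta}(A)=\sup_{d\in\mathcal{D}_{\boldsymbol\Theta,\boldsymbol\delta}}\mathbb{E}_{I\sim d}\left[\frac{\mathrm{ALG}(I)}{\mathrm{OPT}(I)}\right]=\sum_{i=1}^n(\delta_{i-1}-\delta_i)\cdot c_i(A)+\delta_n\cdot r(A).$$
   Context: $[n]=\{1,\dots,n\}$. $\mathcal{I}$ is the set of instances of an online minimization problem. For an algorithm $A$ and instance $I$, $\mathrm{ALG}(I)$ is the expected cost of $A$ on $I$ and $\mathrm{OPT}(I)>0$ is the offline optimal cost, so $\mathrm{ALG}(I)/\mathrm{OPT}(I)\ge 1$. Each consistent set $\Theta_i\subseteq\mathcal{I}$ is nonempty. $\mathcal{D}_{\boldsymbol\Theta,\boldsymbol\delta}$ is the set of all probability distributions $d$ on $\mathcal{I}$ with $\Pr_{I\sim d}[I\in\Theta_i]\ge 1-\delta_i$ for all $i\in[n]$ (point masses are allowed; the $\Theta_i$ and the ratio function are taken to be measurable). The consistencies and robustness are $$c_i(A)=\sup_{I\in\Theta_i}\frac{\mathrm{ALG}(I)}{\mathrm{OPT}(I)}\ (i\in[n]),\qquad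 r(A)=\sup_{I\in\mathcal{I}}\frac{\mathrm{ALG}(I)}{\mathrm{OPT}(I)}.$$ Values are in $[1,+\infty]$, with the convention $0\cdot\infty=0$. *)

(* Defs.v *)
From HB Require Import structures.
From mathcomp Require Import all_boot all_order all_algebra.
From mathcomp Require Import all_classical all_reals all_analysis.
From mathcomp Require Import measurable_realfun.

Set Implicit Arguments.
Unset Strict Implicit.
Unset Printing Implicit Defensive.

Import Order.TTheory GRing.Theory Num.Theory.
Import numFieldNormedType.Exports.

Local Open Scope classical_set_scope.
Local Open Scope ring_scope.
Local Open Scope ereal_scope.

(** A randomized algorithm draws a seed from a probability space; its cost on
    an instance is a nonnegative random variable, possibly [+oo]. No online
    (non-anticipation) constraint is imposed, so the class contains every online
    algorithm. Only the expected cost is required to dominate the offline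
    optimum [opt]. *)
Record algorithm (R : realType) (T : Type) (opt : T -> R) := Algorithm {
  seed_display : measure_display ;
  seed : measurableType seed_display ;
  seed_law : probability seed R ;
  cost : T -> seed -> \bar R ;
  cost_ge0 : forall I s, 0 <= cost I s ;
  measurable_cost : forall I, measurable_fun setT (cost I) ;
  opt_le_expected_cost : forall I,
    (opt I)%:E <= \int[seed_law]_(s in setT) cost I s }.
Arguments cost {R T opt} a I s : rename.

Definition ALG (R : realType) (T : Type) (opt : T -> R) (A : algorithm opt)
    (I : T) : \bar R :=
  \int[seed_law A]_(s in setT) cost A I s.

Definition competitive_ratio (R : realType) (T : Type) (opt : T -> R)
    (A : algorithm opt) (I : T) : \bar R :=
  ALG A I / (opt I)%:E.

Definition consistency (R : realType) (T : Type) (opt : T -> R)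
    (A : algorithm opt) (Theta : set T) : \bar R :=
  ereal_sup [set competitive_ratio A I | I in Theta].

Definition robustness (R : realType) (T : Type) (opt : T -> R)
    (A : algorithm opt) : \bar R :=
  ereal_sup [set competitive_ratio A I | I in setT].

(** Profiles [(Theta_i, delta_i)] are families over [nat] of which only the
    indices [1 <= i <= n] are meaningful; [delta 0] is reserved for the
    convention [delta_0 = 1]. *)
Definition prediction_profile (R : realType) (d : measure_display)
    (T : measurableType d) (n : nat) (Theta : nat -> set T)
    (delta : nat -> R) : Prop :=
  forall i, (1 <= i <= n)%N ->
    [/\ measurable (Theta i), Theta i !=set0 & (0 <= delta i <= 1)%R].

Definition hierarchical (R : realType) (T : Type) (n : nat)
    (Theta : nat -> set T) (delta : nat -> R) : Prop :=
  forall i, (1 <= i < n)%N ->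
    Theta i `<=` Theta i.+1 /\ (delta i.+1 <= delta i)%R.

Definition consistent_distributions (R : realType) (d : measure_display)
    (T : measurableType d) (n : nat) (Theta : nat -> set T)
    (delta : nat -> R) : set (probability T R) :=
  [set D : probability T R |
    forall i, (1 <= i <= n)%N -> (1 - delta i)%:E <= D (Theta i)].

Definition DRCR (R : realType) (d : measure_display) (T : measurableType d)
    (opt : T -> R) (n : nat) (Theta : nat -> set T) (delta : nat -> R)
    (A : algorithm opt) : \bar R :=
  ereal_sup [set \int[D]_(I in setT) competitive_ratio A I |
              D in consistent_distributions n Theta delta].

(* Main.v *)
(** Put [Theta_0 = set0], [Theta_{n+1} = T] and [delta_{n+1} = 0], so that the
    robustness term becomes the last summand.  Upper bound: going from
    [Theta_k] to [Theta_{k+1}], the mass of [Theta_k] in excess of the required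
    [1 - delta_k] is transferred from the supremum over [Theta_k] to the larger
    one over [Theta_{k+1}]; no excess is left at the end.  Keeping the excess as
    a nonnegative real coefficient makes the argument valid for infinite
    suprema.  Lower bound: a mixture of point masses at [x_i \in Theta_i] with
    weights [delta_{i-1} - delta_i] satisfies every constraint, and the [x_i]
    can be chosen independently. *)
Require Import Defs.
From HB Require Import structures.
From mathcomp Require Import all_boot all_order all_algebra.
From mathcomp Require Import all_classical all_reals all_analysis.
From mathcomp Require Import measurable_realfun.
From mathcomp Require Import lra.

Import Order.TTheory GRing.Theory Num.Theory.
Import numFieldNormedType.Exports.

Local Open Scope classical_set_scope.
Local Open Scope ring_scope.
Local Open Scope ereal_scope.

Lemma ge0_integral_le_sup (R : realType) (d : measure_display)
    (T : measurableType d) (P : probability T R) (f : T -> \bar R)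
    (B : set T) :
  (forall x, 0 <= f x) -> measurable_fun setT f -> measurable B ->
  \int[P]_(x in B) f x <= P B * ereal_sup (f @` B).
Proof.
move=> f0 mf mB; rewrite muleC -integral_cst//.
apply: ge0_le_integral => //.
- exact: measurable_funTS.
- by move=> x Bx; apply: ereal_sup_ubound; exists x.
Qed.

(** Induction on [k]: the last summand carries the excess mass of [S k], which the next step charges
    to the larger supremum over [S k.+1]. *)
Lemma integral_chain_le (R : realType) (d : measure_display)
    (T : measurableType d) (P : probability T R) (f : T -> \bar R)
    (S : nat -> set T) (w : nat -> R) :
  (forall x, 0 <= f x) -> measurable_fun setT f ->
  (forall i, measurable (S i)) -> S 0%N = set0 ->
  (forall i, S i.+1 !=set0) -> (forall i, S i `<=` S i.+1) ->
  w 0%N = 1%R -> (forall i, (w i.+1 <= w i)%R) ->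
  (forall i, (1 - w i)%:E <= P (S i)) ->
  forall k, \int[P]_(x in S k) f x <=
    \sum_(0 <= i < k) (w i - w i.+1)%:E * ereal_sup (f @` S i.+1)
    + (fine (P (S k)) - (1 - w k))%:E * ereal_sup (f @` S k).
Proof.
move=> f0 mf mS S0 SN0 Sle w0 wle wP.
have PE i : P (S i) = (fine (P (S i)))%:E by rewrite fineK// fin_num_measure.
have pge i : (1 - w i <= fine (P (S i)))%R by rewrite -lee_fin -PE.
have sup_ge0 i : 0 <= ereal_sup (f @` S i.+1).
  have [x Sx] := SN0 i; apply: le_trans (f0 x) _.
  by apply: ereal_sup_ubound; exists x.
elim=> [|k IH].
  (* The supremum over [S 0 = set0] is [-oo], but its coefficient is exactly 0. *)
  by rewrite big_nil S0 integral_set0 measure0 w0 /= !subrr mul0e adde0.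
have mD : measurable (S k.+1 `\` S k) by exact: measurableD.
have PD : P (S k.+1 `\` S k) = (fine (P (S k.+1)) - fine (P (S k)))%:E.
  rewrite measureD ?ltey_eq ?fin_num_measure//.
  by rewrite setIidr// EFinB -!PE.
have pD : (0 <= fine (P (S k.+1)) - fine (P (S k)))%R.
  by rewrite -lee_fin -PD measure_ge0.
rewrite -(setDUK (Sle k)) ge0_integral_setU//; first last.
- by apply/disj_setPS => x [] /= ? [].
- exact: measurable_funTS.
have ub_D : \int[P]_(x in S k.+1 `\` S k) f x <=
    (fine (P (S k.+1)) - fine (P (S k)))%:E * ereal_sup (f @` S k.+1).
  rewrite -PD; apply: le_trans (@ge0_integral_le_sup _ _ _ P f _ f0 mf mD) _.
  rewrite lee_wpmul2l//; apply: le_ereal_sup; apply: image_subset.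
  by move=> x [].
apply: le_trans (leeD IH ub_D) _.
rewrite big_nat_recr//= -!addeA setDUK//; apply: leeD => //.
have ub_k : (fine (P (S k)) - (1 - w k))%:E * ereal_sup (f @` S k) <=
    (fine (P (S k)) - (1 - w k))%:E * ereal_sup (f @` S k.+1).
  rewrite lee_wpmul2l ?lee_fin ?subr_ge0//.
  by apply: le_ereal_sup; apply: image_subset.
apply: le_trans (leeD ub_k (lexx _)) _.
(* All coefficients are nonnegative, so distributivity holds even for an infinite supremum; both
   sides then have the coefficient [P (S k.+1) - (1 - w k)]. *)
rewrite -!ge0_muleDl ?lee_fin//; try by rewrite subr_ge0.
rewrite -!EFinD.
by rewrite lee_wpmul2r// lee_fin; lra.
Qed.

(** For finite [a], subtract it and move [r] inside the supremum; for [a = +oo], any element of [Y]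
    forces [M = +oo]. *)
Lemma adde_sup_le (R : realType) (Y : set (\bar R)) (a M : \bar R) (r : R) :
  Y !=set0 -> (forall y, Y y -> 0 <= y) -> 0 <= a -> (0 <= r)%R ->
  (forall y, Y y -> a + r%:E * y <= M) -> a + r%:E * ereal_sup Y <= M.
Proof.
move=> [y0 Yy0] Y0 a0 r0 hM.
have aM : a <= M.
  by apply: le_trans (hM _ Yy0); rewrite leeDl// mule_ge0// Y0.
case: a a0 aM hM => [a| |]// a0 aM hM; last first.
  by move: aM; rewrite leye_eq => /eqP ->; rewrite leey.
rewrite -leeBrDl// -ereal_supZl//; last by apply/set0P; exists y0.
by apply: ge_ereal_sup => _ [y Yy <-]; rewrite leeBrDl// hM.
Qed.

(** The points are chosen independently, so each one can be replaced by a supremum in turn, without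
    approximating sequences. *)
Lemma sum_sup_le (R : realType) (T : Type) (f : T -> \bar R)
    (S : nat -> set T) (w : nat -> R) (k : nat) (M : \bar R) :
  (forall x, 0 <= f x) -> (forall i, S i !=set0) ->
  (forall i, (0 <= w i)%R) ->
  (forall x : nat -> T, (forall i, S i (x i)) ->
     \sum_(0 <= i < k) (w i)%:E * f (x i) <= M) ->
  \sum_(0 <= i < k) (w i)%:E * ereal_sup (f @` S i) <= M.
Proof.
move=> f0 SN0 w0 hM.
have sup_ge0 i : 0 <= ereal_sup (f @` S i).
  have [x Sx] := SN0 i; apply: le_trans (f0 x) _.
  by apply: ereal_sup_ubound; exists x.
suff H a : 0 <= a -> (forall x : nat -> T, (forall i, S i (x i)) ->
     a + \sum_(0 <= i < k) (w i)%:E * f (x i) <= M) ->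
  a + \sum_(0 <= i < k) (w i)%:E * ereal_sup (f @` S i) <= M.
  by rewrite -[leLHS]add0e; apply: H => // x Sx; rewrite add0e hM.
(* [a] absorbs the terms whose point has already been fixed. *)
elim: k a {hM} => [|k IH] a a0 hM.
  have [x Sx] := choice SN0; move: (hM x Sx).
  by rewrite !big_nil.
rewrite big_nat_recr//= addeA; apply: adde_sup_le => //.
- by have [x Sx] := SN0 k; exists (f x), x.
- by move=> _ [x _ <-].
- by rewrite adde_ge0// sume_ge0// => i _; rewrite mule_ge0 ?lee_fin.
move=> _ [y Sy <-]; rewrite addeAC; apply: IH.
  by rewrite adde_ge0// mule_ge0// lee_fin.
move=> x Sx; pose x' i := if i == k then y else x i.
have Sx' i : S i (x' i) by rewrite /x'; case: eqP => [->|].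
apply: le_trans (hM x' Sx'); rewrite big_nat_recr//= /x' eqxx addeAC -addeA.
rewrite le_eqVlt; apply/orP; left; apply/eqP; congr (_ + (_ + _)).
by apply: eq_big_nat => i /andP[_ ik]; rewrite ltn_eqF.
Qed.

(** A finite sum of scaled Dirac measures. The first formula serves to check the constraints, the
    second to compute the expected ratio. *)
Lemma exists_discrete_probability (R : realType) (d : measure_display)
    (T : measurableType d) (x : nat -> T) (w : nat -> R) (N : nat) :
  (forall i, (0 <= w i)%R) -> (\sum_(0 <= i < N) w i = 1)%R ->
  exists P : probability T R,
    (forall B, P B = \sum_(0 <= i < N) (w i)%:E * \d_(x i) B) /\
    (forall f : T -> \bar R, (forall t, 0 <= f t) -> measurable_fun setT f ->
       \int[P]_t f t = \sum_(0 <= i < N) (w i)%:E * f (x i)).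
Proof.
move=> w0 w1.
pose m := fun i => mscale (NngNum (w0 i)) (\d_(x i)) : measure T R.
have mE B : msum m N B = \sum_(0 <= i < N) (w i)%:E * \d_(x i) B.
  by rewrite big_mkord /msum.
have mT : msum m N setT = 1.
  rewrite mE -w1 -sumEFin; apply: eq_bigr => i _.
  by rewrite diracT mule1.
pose mu : measure T R := msum m N.
pose P : probability T R := HB.pack (Measure.sort mu) (Measure.class mu)
  (Measure_isProbability.Build _ _ _ mu mT).
exists P; split => // f f0 mf.
rewrite [LHS](ge0_integral_measure_sum m)// big_mkord; apply: eq_bigr => i _.
by rewrite ge0_integral_mscale//= integral_dirac// diracT mul1e.
Qed.

Theorem theorem3 (R : realType) (d : measure_display) (T : measurableType d)
    (opt : T -> R) (opt_gt0 : forall I : T, (0 < opt I)%R)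
    (n : nat) (Theta : nat -> set T) (delta : nat -> R)
    (profile : prediction_profile n Theta delta)
    (hier : hierarchical n Theta delta)
    (delta0 : delta 0%N = 1%R)
    (A : algorithm opt)
    (mratio : measurable_fun setT (competitive_ratio A)) :
  DRCR n Theta delta A =
    \sum_(1 <= i < n.+1)
      (delta i.-1 - delta i)%:E * consistency A (Theta i)
    + (delta n)%:E * robustness A.
Proof.
set f := competitive_ratio A.
have f0 I : 0 <= f I.
  rewrite /f /competitive_ratio mule_ge0//.
    by rewrite integral_ge0// => s _; exact: cost_ge0.
  by rewrite inver gt_eqF// lee_fin invr_ge0 ltW.
(* Constant values beyond [n] make the chain conditions hold at every index. *)
pose S (i : nat) := if i == 0%N then set0 else if (i <= n)%N then Theta i else setT.
pose w i := if (i <= n)%N then delta i else 0%R.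
have S_in i : (1 <= i <= n)%N -> S i = Theta i.
  by rewrite /S; case: i => // i /andP[_ ->].
have w_in i : (i <= n)%N -> w i = delta i by rewrite /w => ->.
have S_last : S n.+1 = setT by rewrite /S /= ltnn.
have w_last : w n.+1 = 0%R by rewrite /w ltnn.
have mS i : measurable (S i).
  rewrite /S; case: i => //= i; case: ifP => // ilen.
  by have [] := profile i.+1 ilen.
have SN0 i : S i.+1 !=set0.
  rewrite /S /=; case: ifP => [ilen|_]; last by exists point.
  by have [] := profile i.+1 ilen.
have Sle i : S i `<=` S i.+1.
  rewrite /S /=; case: i => //= i; case: (ltnP i.+1 n) => [ilen|//].
  by rewrite ltnW//; have [] := hier i.+1 ilen.
have w0 : w 0%N = 1%R by rewrite /w.
have wle i : (w i.+1 <= w i)%R.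
  rewrite /w; case: (ltnP i n) => [iltn|_]; last first.
    (* Here [w i.+1 = 0]. The profile says nothing about index 0, so the case [i = n = 0] relies on
       [delta0]. *)
    case: ifP => // ilen; case: i ilen => [|i] ilen; first by rewrite delta0.
    by have [_ _ /andP[]] := profile i.+1 ilen.
  rewrite ltnW//; case: i iltn => [|i] iltn; last first.
    by have [] := hier i.+1 iltn.
  by rewrite delta0; have [_ _ /andP[]] := profile 1%N iltn.
have wB i : (0 <= w i - w i.+1)%R by rewrite subr_ge0.
have -> : \sum_(1 <= i < n.+1)
      (delta i.-1 - delta i)%:E * consistency A (Theta i)
    + (delta n)%:E * robustness A =
    \sum_(0 <= i < n.+1) (w i - w i.+1)%:E * ereal_sup (f @` S i.+1).
  rewrite [RHS]big_nat_recr//= big_add1 /= S_last w_last subr0 w_in//.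
  congr (_ + _); apply: eq_big_nat => i /andP[_ iltn].
  by rewrite S_in// !w_in// ltnW.
apply/eqP; rewrite eq_le; apply/andP; split.
  apply: ge_ereal_sup => _ [D DP <-].
  have wD i : (1 - w i)%:E <= D (S i).
    case: i => [|i]; first by rewrite w0 subrr measure_ge0.
    case: (ltnP i n) => iltn; first by rewrite S_in// w_in//; exact: DP.
    by rewrite /S /w /= leqNgt ltnS iltn /= subr0 probability_setT.
  have := @integral_chain_le _ _ _ D f S w f0 mratio mS erefl SN0 Sle w0 wle
    wD n.+1.
  (* At [n.+1] the excess is [1 - 1 = 0], which cancels the last term even if the robustness is
     infinite. *)
  by rewrite S_last w_last subr0 probability_setT subrr mul0e adde0.
apply: (@sum_sup_le _ _ f (fun i => S i.+1) (fun i => w i - w i.+1)%R) => //.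
move=> x Sx.
have wsum k : (\sum_(0 <= i < k) (w i - w i.+1) = 1 - w k)%R.
  rewrite -w0; elim: k => [|k IH]; first by rewrite big_nil subrr.
  by rewrite big_nat_recr//= IH; lra.
have [|P [PE PI]] := @exists_discrete_probability R d T x
    (fun i => w i - w i.+1)%R n.+1 wB.
  by rewrite wsum w_last subr0.
rewrite -PI//; apply: ereal_sup_ubound; exists P => // i /andP[i1 ilen].
(* The weights of the first [i] points telescope to [1 - delta i]. For [j < i], the point [x j] lies
   in [S j.+1], hence in [Theta i]; the other points contribute nonnegative mass. *)
rewrite PE -w_in// -wsum -sumEFin (@big_cat_nat _ _ _ i 0 n.+1)//=;
  last exact: ltnW.
rewrite -[leLHS]adde0; apply: leeD; last first.
  by rewrite sume_ge0// => j _; rewrite mule_ge0// lee_fin.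
rewrite le_eqVlt; apply/orP; left; apply/eqP; apply: eq_big_nat => j /andP[_ ji].
rewrite diracE mem_set ?mule1// -S_in ?i1//.
have Smono := homo_leq (@subset_refl _) (fun y x z => @subset_trans _ y x z) Sle.
exact: Smono ji _ (Sx j).
Qed.
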